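(* For $i=1,2$ let $G_i$ be an $r_i$-regular graph of order $n_i$ with $m_i$ edges, with $\mathcal{H}$-eigenvalues $\lambda_{i1}\ge\cdots\ge\lambda_{im_i}$ and adjacency eigenvalues $r_i=\mu_{i1}\ge\mu_{i2}\ge\cdots\ge\mu_{in_i}$. Then the $\mathcal{H}$-spectrum of $G_1\vee G_2$ is the multiset $$\{\lambda_{1t_1}+n_2\}_{1\le t_1\le m_1}\cup\{\lambda_{2t_2}+n_1\}_{1\le t_2\le m_2}\cup\{n_1+n_2\}\cup\{n_1+r_2-\mu_{2k}\}_{2\le k\le n_2}\cup\{n_2+r_1-\mu_{1j}\}_{2\le j\le n_1}\cup\{r_1+r_2-\mu_{1j}-\mu_{2k}\}_{2\le j\le n_1,\,2\le k\le n_2}.$$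
   Context: $G_1\vee G_2$ is the join. Graphs are finite, simple and undirected. Fix an orientation of every edge (tail $e^-$, head $e^+$) and a cyclic orientation of every triangle. $\mathcal{B}$ is the $|E|\times|V|$ matrix with $b_{ev}=-1$ if $v=e^-$, $1$ if $v=e^+$, $0$ otherwise; $\mathcal{C}$ is the $|T|\times|E|$ matrix ($T$ the set of triangles) with $c_{\vartriangle e}=\pm1$ if $e$ is an edge of $\vartriangle$ (sign $+$ iff the orientation of $e$ agrees with that of $\vartriangle$) and $0$ otherwise. The Helmholtzian matrix is $\mathcal{H}(G)=\mathcal{B}\mathcal{B}^{\intercal}+\mathcal{C}^{\intercal}\mathcal{C}$; its eigenvalues ($\mathcal{H}$-eigenvalues, forming the $\mathcal{H}$-spectrum as a multiset) do not depend on the chosen orientations. *)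

(* Defs.v *)
From HB Require Import structures.
From mathcomp Require Import all_boot all_order all_algebra.
Set Implicit Arguments.
Unset Strict Implicit.
Unset Printing Implicit Defensive.
Import Order.TTheory GRing.Theory Num.Theory.
Local Open Scope ring_scope.

Record sgraph := SGraph {
  vertex :> finType;
  adj : rel vertex;
  adj_sym : symmetric adj;
  adj_irr : irreflexive adj }.

Section Graph.
Variable G : sgraph.

Definition edges : {set {set G}} :=
  [set [set x; y] | x in G, y in G & adj x y].

Definition triangles : {set {set G}} :=
  [set t : {set G} | (#|t| == 3%N) &&
     [forall x in t, forall y in t, (x != y) ==> adj x y]].

Definition edge : finType := {e : {set G} | e \in edges}.
Definition triangle : finType := {t : {set G} | t \in triangles}.

Definition regular (r : nat) : Prop :=
  forall x : G, #|[set y | adj x y]| = r.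

(* [cyc t] lists the three vertices of [t]; the cyclic orientation it encodes
   is the successor map [next (cyc t)], so rotating the list changes nothing. *)
Record orientation := Orientation {
  edge_tail : edge -> G;
  edge_head : edge -> G;
  cyc : triangle -> seq G;
  orient_edge : forall e, val e = [set edge_tail e; edge_head e];
  cyc_uniq : forall t, uniq (cyc t);
  cyc_set : forall t, [set:: cyc t] = val t }.

End Graph.

Section Join.
Variables G1 G2 : sgraph.

Definition join_adj : rel (G1 + G2)%type := fun u v =>
  match u, v with
  | inl x, inl y => adj x y
  | inr x, inr y => adj x y
  | _, _ => true
  end.

Fact join_adj_sym : symmetric join_adj.
Proof. by case=> x [] y //=; apply: adj_sym. Qed.

Fact join_adj_irr : irreflexive join_adj.
Proof. by case=> x /=; apply: adj_irr. Qed.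

Definition graph_join : sgraph := SGraph join_adj_sym join_adj_irr.

End Join.

Section Matrices.
Variables (R : rcfType) (G : sgraph).

Definition adjacency : 'M[R]_#|G| :=
  \matrix_(i, j) (adj (enum_val i) (enum_val j))%:R.

Variable o : orientation G.

Definition incidence_coef (e : edge G) (v : G) : R :=
  if v == edge_tail o e then -1 else if v == edge_head o e then 1 else 0.

Definition triangle_coef (t : triangle G) (e : edge G) : R :=
  if val e \subset val t then
    if next (cyc o t) (edge_tail o e) == edge_head o e then 1 else -1
  else 0.

Definition incidence : 'M[R]_(#|edge G|, #|G|) :=
  \matrix_(i, j) incidence_coef (enum_val i) (enum_val j).

Definition triangle_edge : 'M[R]_(#|triangle G|, #|edge G|) :=
  \matrix_(i, j) triangle_coef (enum_val i) (enum_val j).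

Definition helmholtzian : 'M[R]_#|edge G| :=
  incidence *m incidence^T + triangle_edge^T *m triangle_edge.

End Matrices.

(* [s] is the multiset of eigenvalues, with multiplicity, of [M]; the order of
   the entries of [s] is irrelevant. *)
Definition spectrum (R : rcfType) n (M : 'M[R]_n) (s : seq R) : Prop :=
  char_poly M = \prod_(x <- s) ('X - x%:P).

(* Main.v *)
(* Two edges of a triangle contribute opposite signs to B B^T and C^T C, so an
   off-diagonal entry of the Helmholtzian survives only for edges that share a
   vertex and whose other endpoints are not adjacent.  In the join this kills
   every entry between edges of different kinds (inside G1, inside G2, across).
   Up to reorientation, the Helmholtzian of the join is therefore block diagonal
   with blocks H(G1) + n2, H(G2) + n1 and K1 (x) 1 + 1 (x) K2 on the cross edges
   V1 x V2, where Ki = ri - Ai + J.  Every adjacency eigenvalue is at most ri, so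
   mu_i1 = ri belongs to the all-ones vector, and passing from ri - Ai to Ki only
   moves its eigenvalue from 0 to ni. *)

Require Import Defs.
From mathcomp Require Import all_boot all_order all_algebra.
From mathcomp Require Import perm mxtens ring.
Set Implicit Arguments.
Unset Strict Implicit.
Unset Printing Implicit Defensive.
Import Order.TTheory GRing.Theory Num.Theory.
Local Open Scope ring_scope.

(** * Characteristic polynomials *)

(** Over polynomials, [P] intertwines [X - A] and [X - B]; taking determinants, the nonzero constant
    [\det P] cancels. *)
Lemma char_poly_intertwine (F : fieldType) n (P A B : 'M[F]_n) :
  P \in unitmx -> P *m A = B *m P -> char_poly A = char_poly B.
Proof.
move=> uP PA; pose P' := map_mx polyC P.
have dP : \det P' != 0 by rewrite det_map_mx polyC_eq0 -unitfE -unitmxE.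
apply: (mulfI dP); rewrite [RHS]mulrC -!det_mulmx /char_poly_mx.
by rewrite mulmxBl mulmxBr scalar_mxC -!map_mxM PA.
Qed.

Lemma char_poly_lblock (R : comNzRingType) m n (A : 'M[R]_m) (C : 'M_(n, m))
    (B : 'M_n) :
  char_poly (block_mx A 0 C B) = char_poly A * char_poly B.
Proof.
rewrite /char_poly /char_poly_mx map_block_mx map_mx0 scalar_mx_block.
by rewrite opp_block_mx add_block_mx oppr0 addr0 det_lblock.
Qed.

(** Deflation: a row eigenvector for the first root is completed to a basis, the conjugate of [A]
    then has first row [(a, 0)], and induction treats its lower right block. *)
Lemma trigonalization (F : fieldType) n (A : 'M[F]_n) (s : seq F) :
  char_poly A = \prod_(x <- s) ('X - x%:P) ->
  exists P T : 'M[F]_n, [/\ P \in unitmx, is_trig_mx T & P *m A = T *m P].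
Proof.
elim: n A s => [|n IHn] A s cA.
  by exists 1%:M, A; split; rewrite ?unitmx1 ?mul1mx ?mulmx1 //; apply/is_trig_mxP => -[].
have sz : size s = n.+1.
  by move: (size_char_poly A); rewrite cA size_prod_XsubC => -[].
case: s sz cA => // a s _ cA.
have : eigenvalue A a by rewrite eigenvalue_root_char cA root_prod_XsubC mem_head.
case/eigenvalueP => v vA v0.
have rv : \rank v = 1%N by apply/eqP; rewrite rank_rV v0.
pose Q := row_ebase v; have uQ : Q \in unitmx by apply: row_ebase_unit.
pose B : 'M_(1 + n) := Q *m A *m invmx Q.
(* Since [v] has rank one, the first row of [row_ebase v] is a nonzero multiple of [v], hence a left
   eigenvector of [A]. *)
have Bu : usubmx B = row_mx a%:M 0.
  have vE : v = col_ebase v 0 0 *: (pid_mx 1 *m Q).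
    rewrite -{1}(mulmx_ebase v) rv -mulmxA [col_ebase v]mx11_scalar.
    by rewrite mul_scalar_mx mxE eqxx mulr1n.
  have c0 : col_ebase v 0 0 != 0 by apply: contraNneq v0 => c0; rewrite vE c0 scale0r.
  have pE (M : 'M[F]_(1 + n)) : usubmx M = pid_mx 1 *m M.
    by rewrite pid_mx_row -{2}[M]vsubmxK mul_row_col mul1mx mul0mx addr0.
  rewrite pE /B !mulmxA.
  have qE : pid_mx 1 *m Q = (col_ebase v 0 0)^-1 *: v.
    by rewrite {2}vE scalerA mulVf // scale1r.
  have -> : pid_mx 1 *m Q *m A = a *: (pid_mx 1 *m Q) :> 'rV_n.+1.
    by rewrite qE -scalemxAl vA !scalerA mulrC.
  by rewrite -scalemxAl mulmxK // pid_mx_row scale_row_mx scaler0 scalemx1.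
have BE : B = block_mx a%:M 0 (dlsubmx B) (drsubmx B).
  by rewrite -[LHS]submxK /ulsubmx /ursubmx Bu row_mxKl row_mxKr.
have cB : char_poly A = char_poly B.
  by apply: (char_poly_intertwine uQ); rewrite mulmxKV.
have [|P [T [uP tT PT]]] := IHn (drsubmx B) s.
  (* Cancelling the factor of [a] leaves exactly the roots [s] for the lower right block. *)
  have /mulfI : 'X - a%:P != 0 by rewrite polyXsubC_eq0.
  apply; rewrite big_cons /= in cA; rewrite -cA cB {2}BE char_poly_lblock; congr (_ * _).
  by rewrite /char_poly det_mx11 !mxE.
pose P1 : 'M_(1 + n) := block_mx 1%:M 0 0 P.
pose T1 : 'M_(1 + n) := block_mx a%:M 0 (P *m dlsubmx B) T.
exists (P1 *m Q), T1; split.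
- have dP1 : \det P1 = \det P by rewrite det_lblock det1 mul1r.
  by rewrite unitmx_mul uQ andbT unitmxE [\det _]dP1 -unitmxE.
- have : is_trig_mx T1 by rewrite is_trig_block_mx // eqxx tT mx11_is_trig.
  by [].
- have key : P1 *m B = T1 *m P1.
    rewrite BE !mulmx_block.
    by rewrite !mul1mx !mul0mx !mulmx0 !mulmx1 !addr0 !add0r PT.
  have QA : Q *m A = B *m Q by rewrite mulmxKV.
  by rewrite -[LHS]mulmxA QA [LHS]mulmxA key mulmxA.
Qed.

(** The diagonal of [T] and [s] list the roots of one split polynomial, so they agree up to order.
    Spectra can thus be read off diagonals. *)
Lemma trigonalization_perm (F : fieldType) n (A : 'M[F]_n) (s : seq F) :
  char_poly A = \prod_(x <- s) ('X - x%:P) ->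
  exists P T : 'M[F]_n, [/\ P \in unitmx, is_trig_mx T, P *m A = T *m P &
    perm_eq s [seq T i i | i <- enum 'I_n]].
Proof.
move=> cA; have [P [T [uP tT PT]]] := trigonalization cA.
exists P, T; split=> //; apply: prod_XsubC_eq; rewrite -cA big_map big_enum /=.
by rewrite (char_poly_intertwine uP PT) char_poly_trig.
Qed.

(** The change of basis that triangularizes [A] also triangularizes [a *: A + c%:M]. *)
Lemma char_poly_affine (F : fieldType) n (A : 'M[F]_n) (s : seq F) a c :
  char_poly A = \prod_(x <- s) ('X - x%:P) ->
  char_poly (a *: A + c%:M) = \prod_(x <- s) ('X - (a * x + c)%:P).
Proof.
case/trigonalization_perm => P [T [uP tT PT sT]].
rewrite (perm_big _ sT) big_map big_enum /=.
rewrite (@char_poly_intertwine _ _ P _ (a *: T + c%:M)) //.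
  rewrite char_poly_trig; first by apply: eq_bigr => i _; rewrite !mxE eqxx.
  apply/is_trig_mxP => i j ij; rewrite !mxE (is_trig_mxP tT) // mulr0 add0r.
  by rewrite -val_eqE ltn_eqF.
by rewrite mulmxDl mulmxDr -scalemxAl -scalemxAr PT scalar_mxC.
Qed.

(** If [P] and [Q] triangularize [A] and [B], then [P *t Q] triangularizes the Kronecker sum, with
    diagonal entries [T i i + U j j]. *)
Lemma char_poly_kronecker_sum (F : fieldType) m n (A : 'M[F]_m) (B : 'M[F]_n)
    (s t : seq F) :
  char_poly A = \prod_(x <- s) ('X - x%:P) ->
  char_poly B = \prod_(x <- t) ('X - x%:P) ->
  char_poly (A *t (1%:M : 'M_n) + (1%:M : 'M_m) *t B) =
    \prod_(x <- [seq a + b | a <- s, b <- t]) ('X - x%:P).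
Proof.
case/trigonalization_perm => P [T [uP tT PT sT]].
case/trigonalization_perm => Q [U [uQ tU QU tU']].
rewrite big_allpairs_dep /= (perm_big _ sT) big_map big_enum /=.
under eq_bigr do rewrite (perm_big _ tU') big_map big_enum /=.
rewrite pair_big_dep /=.
rewrite (@char_poly_intertwine _ _ (P *t Q) _ (T *t 1%:M + 1%:M *t U)); last first.
- by rewrite mulmxDl mulmxDr !tensmx_mul PT QU !mul1mx !mulmx1.
- have tens1 : (1%:M : 'M[F]_m) *t (1%:M : 'M[F]_n) = 1%:M.
    apply/matrixP => x y; case: (mxtens_indexP x) => i j; case: (mxtens_indexP y) => k l.
    rewrite tensmxE !mxE (can_eq (@mxtens_indexK m n)) xpair_eqE.
    by case: eqP => _; case: eqP => _; rewrite ?mulr1 ?mul0r ?mulr0.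
  suff /mulmx1_unit[] : (P *t Q) *m (invmx P *t invmx Q) = 1%:M by [].
  by rewrite tensmx_mul !mulmxV.
rewrite char_poly_trig.
  rewrite (reindex (@mxtens_index m n)) /=.
    by apply: eq_bigr => -[i j] _; rewrite mxE !tensmxE !mxE !eqxx mulr1 mul1r.
  exact/onW_bij/(Bijective (@mxtens_indexK m n) (@mxtens_unindexK m n)).
apply/is_trig_mxP => x y; case: (mxtens_indexP x) => i j; case: (mxtens_indexP y) => k l.
rewrite mxE !tensmxE !mxE /= => lt.
(* The pair [(i, j)] has index [i * n + j], so indices are ordered lexicographically: either
   [i < k], or [i = k] and [j < l]. *)
have [ik|ki|/val_inj ik] := ltngtP i k.
- by rewrite (is_trig_mxP tT) // mul0r add0r -val_eqE /= ltn_eqF // mul0r.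
- suff : (k * n + l < i * n + j)%N by move/(ltn_trans lt); rewrite ltnn.
  apply: (@leq_trans (k.+1 * n)); last by rewrite (leq_trans (leq_mul ki (leqnn n))) ?leq_addr.
  by rewrite mulSn addnC ltn_add2r.
- have jl : (j < l)%N by move: lt; rewrite ik ltn_add2l.
  by rewrite (is_trig_mxP tU) // mulr0 addr0 -(val_eqE j) /= ltn_eqF // mulr0.
Qed.

(* Both sides are the determinant of [[X - a, -v], [0, 1]] * [[1, v], [w, X - A]]:
   the left one by clearing w, the right one because v (X - A) = (X - a) v. *)
Lemma char_poly_brauer (R : idomainType) n (A : 'M[R]_n) (v : 'rV_n) (w : 'cV_n) a :
  v *m A = a *: v ->
  ('X - a%:P) * char_poly (A + w *m v) =
  ('X - (a + (v *m w) 0 0)%:P) * char_poly A.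
Proof.
move=> vA; pose N := char_poly_mx A.
pose v' := map_mx polyC v; pose w' := map_mx polyC w.
have vN : v' *m N = ('X - a%:P) *: v'.
  rewrite mulmxBr -map_mxM vA scalar_mxC mul_scalar_mx scalerBl map_mxZ //.
have cE : char_poly_mx (A + w *m v) = N - w' *m v'.
  by rewrite /char_poly_mx map_mxD map_mxM opprD addrA.
have -> : char_poly (A + w *m v) = \det (block_mx 1%:M v' w' N).
  have -> : block_mx 1%:M v' w' N =
      block_mx 1%:M 0 w' 1%:M *m block_mx 1%:M v' 0 (N - w' *m v').
    by rewrite mulmx_block !mul1mx !mul0mx !mulmx1 !addr0 addrC subrK.
  by rewrite det_mulmx det_lblock det_ublock !det1 !mul1r /char_poly cE.
have -> : 'X - a%:P = \det (block_mx ('X - a%:P)%:M (- v') 0 (1%:M : 'M_n)).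
  by rewrite det_ublock det1 mulr1 det_mx11 mxE mulr1n.
rewrite -det_mulmx mulmx_block !mul0mx !mul1mx !add0r.
rewrite !mul_scalar_mx [- v' *m N]mulNmx vN subrr det_lblock; congr (_ * _).
rewrite det_mx11 mulNmx -map_mxM !mxE eqxx mulr1.
by rewrite polyCD opprD addrA.
Qed.

(** Similarity through a permutation matrix with rows scaled by [s]. The sizes [m] and [n] are
    distinct variables because in the application they are different expressions for the number of
    edges of the join. *)
Lemma char_poly_reindex (F : fieldType) m n (f : 'I_m -> 'I_n) (s : 'I_m -> F)
    (M : 'M_m) (N : 'M_n) :
  bijective f -> (forall i, s i != 0) ->
  (forall i j, M i j * s j = s i * N (f i) (f j)) ->
  char_poly M = char_poly N.
Proof.
move=> bf s0 MN.
have mn : m = n by have := bij_eq_card bf; rewrite !card_ord.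
case: n / mn f N bf MN => f N bf MN.
pose P : 'M[F]_m := \matrix_(i, j) (s i *+ (f i == j)).
have injf := bij_inj bf.
have uP : P \in unitmx.
  have -> : P = diag_mx (\row_i s i) *m perm_mx (perm injf).
    by apply/matrixP => i j; rewrite mul_diag_mx !mxE permE mulr_natr.
  rewrite unitmx_mul unitmx_perm andbT unitmxE det_diag unitfE.
  by apply/prodf_neq0 => i _; rewrite mxE.
apply/esym/(char_poly_intertwine uP)/matrixP => i j.
have [g fK gK] := bf.
rewrite !mxE (bigD1 (f i)) //= mxE eqxx big1 ?addr0 => [|k ki]; last first.
  by rewrite mxE eq_sym (negPf ki) mul0r.
rewrite (bigD1 (g j)) //= mxE gK eqxx big1 ?addr0 => [|k ki]; last first.
  by rewrite mxE -{1}[j]gK (inj_eq injf) (negPf ki) mulr0.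
by rewrite MN gK mulr1n.
Qed.

(** * Adjacency spectrum of a regular graph *)

Lemma sum_delta (R : pzRingType) (T : finType) (a : T) (F : T -> R) :
  \sum_x (x == a)%:R * F x = F a.
Proof.
rewrite (bigD1 a) //= eqxx mul1r big1 ?addr0 // => x /negPf ->.
by rewrite mul0r.
Qed.

Lemma regular_sum (R : pzRingType) (G : sgraph) r :
  regular G r -> forall x : G, \sum_y (adj x y)%:R = r%:R :> R.
Proof.
move=> regG x; rewrite -(regG x) cardsE -sum1_card natr_sum [RHS]big_mkcond /=.
by apply: eq_bigr => y _; rewrite -[_ \in _]/(adj x y); case: (adj x y).
Qed.

Section Regular.
Variables (R : rcfType) (G : sgraph) (r : nat).
Hypothesis regG : regular G r.
Local Notation A := (adjacency R G).
Local Notation ones := (const_mx 1 : 'M[R]_(_, _)).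

Lemma sum_adjacency (j : 'I_#|G|) : \sum_i A i j = r%:R.
Proof.
under eq_bigr do rewrite mxE adj_sym.
rewrite -(regular_sum R regG (enum_val j)).
by rewrite [RHS](reindex _ (onW_bij _ (@enum_val_bij G))).
Qed.

Lemma ones_adjacency : (ones : 'rV_#|G|) *m A = r%:R *: ones.
Proof.
apply/rowP => j; rewrite !mxE mulr1 -(sum_adjacency j).
by apply: eq_bigr => i _; rewrite mxE mul1r.
Qed.

Lemma adjacency_eigenvalue_le b : eigenvalue A b -> b <= r%:R.
Proof.
case/eigenvalueP => v vA v0.
have /rV0Pn[k0 _] := v0.
(* At an entry of v of largest modulus, |b| |v_k| <= sum_i A_ik |v_i| <= r |v_k|. *)
pose k := [arg max_(i > k0) `|v 0 i|]%O.
have kmax i : `|v 0 i| <= `|v 0 k| by rewrite /k; case: arg_maxP => // j _; apply.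
have vk : 0 < `|v 0 k|.
  rewrite normr_gt0; apply: contraNneq v0 => vk; apply/eqP/rowP => i.
  by apply/eqP; rewrite mxE -normr_le0 -(normr0 R) -vk kmax.
apply: (le_trans (ler_norm b)); rewrite -(ler_pM2r vk) -normrM.
have -> : b * v 0 k = \sum_i v 0 i * A i k by move/rowP/(_ k): vA; rewrite !mxE.
apply: (le_trans (ler_norm_sum _ _ _)); rewrite -(sum_adjacency k) mulr_suml.
apply: ler_sum => i _; rewrite normrM mulrC [`|A i k|]ger0_norm.
  by rewrite ler_wpM2l // mxE ler0n.
by rewrite mxE ler0n.
Qed.

(** The all-ones vector, nonzero as [n > 0], shows that [r] is an eigenvalue; no eigenvalue exceeds
    it, so it heads a decreasing list. *)
Lemma regular_spectrum_head n (mu : n.-tuple R) :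
  (0 < n)%N -> #|G| = n -> sorted >=%R mu -> spectrum A mu ->
  tval mu = r%:R :: behead mu.
Proof.
move=> n0 cG smu specmu.
have muE x : (x \in tval mu) = eigenvalue A x.
  by rewrite eigenvalue_root_char specmu root_prod_XsubC.
have rmu : r%:R \in tval mu.
  rewrite muE; apply/eigenvalueP; exists ones; first exact: ones_adjacency.
  have i : 'I_#|G| by rewrite cG; exists 0%N.
  by apply/eqP => /rowP/(_ i)/eqP; rewrite !mxE oner_eq0.
have mule x : x \in tval mu -> x <= r%:R by rewrite muE; apply: adjacency_eigenvalue_le.
case: (tval mu) smu rmu mule => //= x s srt rin le; congr (_ :: _).
apply/eqP; rewrite eq_le le ?mem_head //=.
move: rin; rewrite inE => /orP[/eqP -> //|].
have /= := srt; rewrite path_sortedE; last by move=> a b c /= ba ac; apply: le_trans ac ba.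
by case/andP => /allP H _ /H.
Qed.

(** The Laplacian of an [r]-regular graph plus the all-ones matrix; this is the form in which the
    cross edges of the join produce it. *)
Definition shifted_laplacian : 'M[R]_#|G| := - A + r%:R%:M + const_mx 1.

(** The all-ones row is a left null vector of [r - A], so adding the rank-one all-ones matrix moves
    that eigenvalue from 0 to [#|G|] and keeps the others. *)
Lemma char_poly_shifted_laplacian (s : seq R) :
  spectrum A (r%:R :: s) ->
  spectrum shifted_laplacian (#|G|%:R :: [seq r%:R - b | b <- s]).
Proof.
rewrite /spectrum => sp.
have := char_poly_affine (-1) r%:R sp; rewrite big_cons mulN1r addNr scaleN1r subr0 => cL.
have L0 : (ones : 'rV_#|G|) *m (- A + r%:R%:M) = 0 *: ones.
  by rewrite mulmxDr mulmxN ones_adjacency mul_mx_scalar addNr scale0r.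
have := char_poly_brauer (const_mx 1 : 'cV_#|G|) L0.
have -> : (const_mx 1 : 'cV[R]_#|G|) *m (const_mx 1 : 'rV_#|G|) = const_mx 1.
  by apply/matrixP => i j; rewrite !mxE big_ord1 !mxE mulr1.
have -> : ((const_mx 1 : 'rV[R]_#|G|) *m (const_mx 1 : 'cV_#|G|)) 0 0 = #|G|%:R.
  by rewrite mxE; under eq_bigr do rewrite !mxE mulr1; rewrite sumr_const card_ord.
rewrite add0r subr0 cL mulrCA => /mulfI -> //; last by rewrite polyX_eq0.
by rewrite big_cons big_map; under eq_bigr do rewrite mulN1r [- _ + r%:R]addrC.
Qed.

End Regular.

(** * Entries of the Helmholtzian *)

Section Entries.
Variables (R : rcfType) (G : sgraph).

Definition common_nbrs (a b : G) : R := #|[set x | adj a x && adj b x]|%:R.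
Definition nonadj (a b : G) : R := 1 - (adj a b)%:R.

(** Identity matrix on oriented edges, made antisymmetric under reversal: 1 for equal edges, -1 for
    opposite ones. *)
Definition edge_delta (a b c d : G) : R :=
  (a == c)%:R * (b == d)%:R - (a == d)%:R * (b == c)%:R.

(* Entry at the oriented edges a -> b and c -> d.  For adjacent a, b the terms in
   [nonadj] already add up to 2 on the diagonal, because [nonadj a a = 1]. *)
Definition helmholtzian_entry (a b c d : G) : R :=
  (a == c)%:R * nonadj b d + (b == d)%:R * nonadj a c
  - (a == d)%:R * nonadj b c - (b == c)%:R * nonadj a d
  + common_nbrs a b * edge_delta a b c d.

Lemma common_nbrsE a b : common_nbrs a b = \sum_x (adj a x && adj b x)%:R.
Proof.
rewrite /common_nbrs cardsE -sum1_card natr_sum [LHS]big_mkcond /=.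
by apply: eq_bigr => x _; rewrite unfold_in /=; case: andP.
Qed.

Lemma common_nbrsC a b : common_nbrs a b = common_nbrs b a.
Proof. by rewrite !common_nbrsE; apply: eq_bigr => x _; rewrite andbC. Qed.

(** Antisymmetry in each edge is what makes a change of orientation a conjugation by signs. *)
Lemma helmholtzian_entry_flipl a b c d :
  helmholtzian_entry b a c d = - helmholtzian_entry a b c d.
Proof. by rewrite /helmholtzian_entry /edge_delta (common_nbrsC b); ring. Qed.

Lemma helmholtzian_entry_flipr a b c d :
  helmholtzian_entry a b d c = - helmholtzian_entry a b c d.
Proof. by rewrite /helmholtzian_entry /edge_delta; ring. Qed.

Variable o : orientation G.

Lemma edge_adj (e : edge G) : adj (edge_tail o e) (edge_head o e).
Proof.
have /imset2P[x y _ /=] := valP e; rewrite inE => xy.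
rewrite (orient_edge o e) => E.
have xy' : x != y by apply: contraTneq xy => ->; rewrite adj_irr.
have : edge_tail o e \in [set x; y] by rewrite -E set21.
have : edge_head o e \in [set x; y] by rewrite -E set22.
have : x \in [set edge_tail o e; edge_head o e] by rewrite E set21.
have : y \in [set edge_tail o e; edge_head o e] by rewrite E set22.
rewrite !inE => h1 h2 /orP[]/eqP h3 /orP[]/eqP h4; rewrite h3 h4 in h1 h2 *.
- by move: h1; rewrite orbb eq_sym (negPf xy').
- by rewrite adj_sym.
- by [].
- by move: h2; rewrite orbb (negPf xy').
Qed.

Lemma adj_neq (a b : G) : adj a b -> a != b.
Proof. by apply: contraTneq => ->; rewrite adj_irr. Qed.

Lemma incidence_gram (e f : edge G) :
  \sum_v incidence_coef R o e v * incidence_coef R o f v =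
  (edge_tail o e == edge_tail o f)%:R + (edge_head o e == edge_head o f)%:R
  - (edge_tail o e == edge_head o f)%:R - (edge_head o e == edge_tail o f)%:R.
Proof.
(* Tail and head differ, so the nested test is a difference of two indicators and the sum over [v]
   collapses. *)
have coefE g v : incidence_coef R o g v = (v == edge_head o g)%:R - (v == edge_tail o g)%:R.
  have th := adj_neq (edge_adj g); rewrite /incidence_coef.
  have [->|_] := eqVneq v (edge_tail o g); first by rewrite (negPf th) sub0r.
  by rewrite subr0; case: eqP.
under eq_bigr => v _ do rewrite [in X in X * _]coefE mulrBl.
rewrite sumrB !sum_delta !coefE; ring.
Qed.

(** Extends [triangle_coef] to arbitrary vertex pairs; for a list without repetition it is invariant
    under rotation. *)
Definition cyclic_sign (s : seq G) (c d : G) : R :=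
  if (c \in s) && (d \in s) then if next s c == d then 1 else -1 else 0.

Lemma triangle_coefE t e :
  triangle_coef R o t e = cyclic_sign (cyc o t) (edge_tail o e) (edge_head o e).
Proof.
rewrite /triangle_coef /cyclic_sign (orient_edge o) -(cyc_set o t).
by rewrite subUset !sub1set !inE.
Qed.

(* The product of the signs of a -> b and c -> d in the triangle a, b, x. *)
Definition third_sign (a b x c d : G) : R :=
    (a == c)%:R * (b == d)%:R + (b == c)%:R * (x == d)%:R
  + (x == c)%:R * (a == d)%:R - (b == c)%:R * (a == d)%:R
  - (x == c)%:R * (b == d)%:R - (a == c)%:R * (x == d)%:R.

(** After rotation [s] is [a, b, x] or [a, x, b]. Passing from one to the other flips both signs, so
    the product does not see the cyclic orientation; the rest is a case check on [c] and [d]. *)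
Lemma cyclic_sign_mul s a b x c d :
  uniq [:: a; b; x] -> c != d -> perm_eq s [:: a; b; x] ->
  cyclic_sign s a b * cyclic_sign s c d = third_sign a b x c d.
Proof.
move=> u cd ps.
have us : uniq s by rewrite (perm_uniq ps).
have as_ : a \in s by rewrite (perm_mem ps) mem_head.
have [i p def_s] := rot_to as_.
have pp : perm_eq p [:: b; x].
  by rewrite -(perm_cons a) -def_s perm_rot.
have csE y z : cyclic_sign s y z = cyclic_sign (a :: p) y z.
  by rewrite /cyclic_sign -def_s next_rot // !mem_rot.
rewrite !{}csE; move: u; rewrite /= !inE !negb_or andbT -!andbA => /and3P[ab ax bx].
have : p = [:: b; x] \/ p = [:: x; b].
  have sp := perm_size pp; case: p {def_s} pp sp => [|y [|z []]] //= pp _.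
  have := perm_mem pp y; rewrite !inE eqxx /= => /esym/orP[]/eqP ey; rewrite ey in pp *.
    by left; move: pp; rewrite perm_cons => /perm_mem/(_ z); rewrite !inE eqxx => /esym/eqP ->.
  right; move: pp; rewrite (perm_sym _ [:: b; x]) -(perm_rot 1) perm_sym.
  by rewrite perm_cons => /perm_mem/(_ z); rewrite !inE eqxx => /esym/eqP ->.
have [ba xa xb] : [/\ b != a, x != a & x != b] by rewrite ![_ == a]eq_sym [x == b]eq_sym.
have neqs := (negPf ab, negPf ax, negPf bx, negPf ba, negPf xa, negPf xb, eqxx).
have dc : d != c by rewrite eq_sym.
rewrite /cyclic_sign /third_sign => p_eq.
case: (eqVneq c a) => [ca|ca];
  [|case: (eqVneq c b) => [cb|cb]; [|case: (eqVneq c x) => [cx|cx]]].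
- rewrite ca in cd dc *; case: (eqVneq d b) => [db|db]; [|case: (eqVneq d x) => [dx|dx]].
  + case: p_eq => ->; rewrite ?db !inE /= ?neqs /=; ring.
  + case: p_eq => ->; rewrite ?dx !inE /= ?neqs /=; ring.
  + case: p_eq => ->; rewrite !inE ?neqs ?(negPf cd) ?(negPf dc) ?(negPf db) ?(negPf dx) /=; ring.
- rewrite cb in cd dc *; case: (eqVneq d a) => [da|da]; [|case: (eqVneq d x) => [dx|dx]].
  + case: p_eq => ->; rewrite ?da !inE /= ?neqs /=; ring.
  + case: p_eq => ->; rewrite ?dx !inE /= ?neqs /=; ring.
  + case: p_eq => ->; rewrite !inE ?neqs ?(negPf cd) ?(negPf dc) ?(negPf da) ?(negPf dx) /=; ring.
- rewrite cx in cd dc *; case: (eqVneq d a) => [da|da]; [|case: (eqVneq d b) => [db|db]].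
  + case: p_eq => ->; rewrite ?da !inE /= ?neqs /=; ring.
  + case: p_eq => ->; rewrite ?db !inE /= ?neqs /=; ring.
  + case: p_eq => ->; rewrite !inE ?neqs ?(negPf cd) ?(negPf dc) ?(negPf da) ?(negPf db) /=; ring.
case: p_eq => ->; rewrite !inE ?(negPf ca) ?(negPf cb) ?(negPf cx) /=; ring.
Qed.

(** Allows the triangles through an edge to be counted by their third vertex. *)
Lemma triangles_setU1 (a b x : G) : adj a b ->
  (x \notin [set a; b]) && (x |: [set a; b] \in triangles G) = adj a x && adj b x.
Proof.
move=> ab; rewrite !inE negb_or.
apply/idP/andP => [/and3P[/andP[xa xb] _ /forallP H]|[ax bx]].
  have K y : y \in [set a; b] -> adj y x.
    move=> yab; have /implyP/(_ _)/forallP/(_ x)/implyP/(_ _)/implyP := H y.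
    apply; [by rewrite setU1r | by rewrite setU11 |].
    by rewrite eq_sym; move: yab; rewrite !inE => /orP[]/eqP->.
  by rewrite !K ?set21 ?set22.
have [xa xb] : x != a /\ x != b by rewrite ![x == _]eq_sym !adj_neq.
rewrite xa xb cardsU1 cards2 !inE (negPf xa) (negPf xb) (adj_neq ab) /=.
apply/forallP => y; apply/implyP; rewrite !inE => /or3P[]/eqP->;
  apply/forallP => z; apply/implyP; rewrite !inE => /or3P[]/eqP->;
  by rewrite ?eqxx // ?ab ?ax ?bx ?implybT // adj_sym ?ab ?ax ?bx implybT.
Qed.

(** At most one summand is nonzero, that of the third vertex of [t] when [t] contains [e]. The form
    as a sum allows the sums over triangles and vertices to be exchanged. *)
Lemma triangle_coef_mul t e f :
  triangle_coef R o t e * triangle_coef R o t f =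
  \sum_x ((val t == x |: val e) && (x \notin val e))%:R *
     third_sign (edge_tail o e) (edge_head o e) x (edge_tail o f) (edge_head o f).
Proof.
have [et|et] := boolP (val e \subset val t); last first.
  rewrite {1}/triangle_coef (negPf et) mul0r big1 // => x _.
  case: eqP => [E|_]; last by rewrite mul0r.
  by rewrite E subsetUr in et.
have ab := adj_neq (edge_adj e).
have ce : #|val e| = 2 by rewrite (orient_edge o) cards2 ab.
have ct : #|val t| = 3%N by have := valP t; rewrite inE => /andP[/eqP].
have /eqP/cards1P[x tx] : #|val t :\: val e| = 1%N.
  by rewrite cardsD (setIidPr et) ct ce.
have xe : x \notin val e.
  by have : x \in val t :\: val e; [rewrite tx set11 | rewrite inE => /andP[]].
have tE : val t = x |: val e by rewrite -tx setUC -{1}(setIidPr et) setID.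
under eq_bigr => y _.
  have -> : (val t == y |: val e) && (y \notin val e) = (y == x).
    apply/andP/eqP => [[/eqP E ye]|->]; last by rewrite tE eqxx.
    apply/eqP; rewrite -in_set1 -tx E !inE eqxx ye //.
  over.
rewrite sum_delta !triangle_coefE; apply: cyclic_sign_mul.
- move: xe; rewrite (orient_edge o) !inE negb_or => /andP[xa xb] /=.
  by rewrite !inE negb_or ab /= andbT eq_sym xa eq_sym.
- exact: adj_neq (edge_adj f).
apply: uniq_perm; first exact: cyc_uniq.
  move: xe; rewrite (orient_edge o) !inE negb_or => /andP[xa xb] /=.
  by rewrite !inE negb_or ab /= andbT eq_sym xa eq_sym.
move=> y; have := cyc_set o t => /setP/(_ y); rewrite !inE => ->.
by rewrite tE (orient_edge o) !inE orbC orbA.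
Qed.

Lemma triangle_gram (e f : edge G) :
  let a := edge_tail o e in let b := edge_head o e in
  let c := edge_tail o f in let d := edge_head o f in
  \sum_t triangle_coef R o t e * triangle_coef R o t f =
  common_nbrs a b * edge_delta a b c d
  - (a == c)%:R * (adj b d)%:R - (b == d)%:R * (adj a c)%:R
  + (a == d)%:R * (adj b c)%:R + (b == c)%:R * (adj a d)%:R.
Proof.
move=> a b c d; have ab : adj a b := edge_adj e; have cd : adj c d := edge_adj f.
under eq_bigr do rewrite triangle_coef_mul.
(* For fixed [x] the inner sum counts the triangles made of [e] and [x]: one if [x] is a common
   neighbour, none otherwise. *)
rewrite exchange_big /=.
under eq_bigr => x _.
  rewrite -mulr_suml.
  have -> : \sum_(t : triangle G) ((val t == x |: val e) && (x \notin val e))%:R =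
      (adj a x && adj b x)%:R :> R.
    rewrite -triangles_setU1 // (orient_edge o e) -/a -/b.
    have [xe|xe] := boolP (x \notin _); last by rewrite big1 // => t _; rewrite andbF.
    have [tT|tT] /= := boolP (_ \in triangles G).
      pose t0 : triangle G := exist (fun t => t \in triangles G) _ tT.
      rewrite (bigD1 t0) //= eqxx big1 ?addr0 // => t.
      by rewrite -val_eqE /= => /negPf ->.
    rewrite big1 // => t _; case: eqP => // E.
    by case/negP: tT; rewrite -E; apply: (valP t).
  over.
pose n x : R := (adj a x && adj b x)%:R.
have nE x : n x = (adj a x)%:R * (adj b x)%:R by rewrite /n -mulnb natrM.
(* [third_sign] is sorted by its dependence on [x]: the constant part yields [common_nbrs], and
   [sum_delta] evaluates the other two at [d] and [c]. *)
rewrite (eq_bigr (fun x => n x * ((a == c)%:R * (b == d)%:R - (b == c)%:R * (a == d)%:R)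
   + (x == d)%:R * (n x * ((b == c)%:R - (a == c)%:R))
   + (x == c)%:R * (n x * ((a == d)%:R - (b == d)%:R)))); last first.
  by move=> x _; rewrite /third_sign -/(n x) -/a -/b -/c -/d; ring.
rewrite !big_split /= !sum_delta -mulr_suml -common_nbrsE !nE.
(* As [c] and [d] are adjacent, each such equality forces one adjacency, so products of two
   adjacencies reduce to a single one. *)
have e1 : (b == c)%:R * (adj b d)%:R = (b == c)%:R :> R.
  by case: eqP => [->|_]; rewrite ?cd ?mulr1 ?mul0r.
have e2 : (a == c)%:R * (adj a d)%:R = (a == c)%:R :> R.
  by case: eqP => [->|_]; rewrite ?cd ?mulr1 ?mul0r.
have e3 : (a == d)%:R * (adj a c)%:R = (a == d)%:R :> R.
  by case: eqP => [->|_]; rewrite 1?adj_sym ?cd ?mulr1 ?mul0r.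
have e4 : (b == d)%:R * (adj b c)%:R = (b == d)%:R :> R.
  by case: eqP => [->|_]; rewrite 1?adj_sym ?cd ?mulr1 ?mul0r.
have -> : (adj a d)%:R * (adj b d)%:R * ((b == c)%:R - (a == c)%:R) =
    (b == c)%:R * (adj a d)%:R - (a == c)%:R * (adj b d)%:R :> R.
  by rewrite -[in RHS]e1 -[in RHS]e2; ring.
have -> : (adj a c)%:R * (adj b c)%:R * ((a == d)%:R - (b == d)%:R) =
    (a == d)%:R * (adj b c)%:R - (b == d)%:R * (adj a c)%:R :> R.
  by rewrite -[in RHS]e3 -[in RHS]e4; ring.
rewrite /edge_delta; ring.
Qed.

(** Both edges are oriented by the same [o], so the value -1 of opposite edges cannot occur. *)
Lemma edge_deltaE (e f : edge G) :
  edge_delta (edge_tail o e) (edge_head o e) (edge_tail o f) (edge_head o f) =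
  (e == f)%:R.
Proof.
have ef := adj_neq (edge_adj e); rewrite /edge_delta.
have [->|nef] := eqVneq e f.
  by rewrite !eqxx (negPf (adj_neq (edge_adj f))) mul0r subr0 mul1r.
have nE : val e != val f by rewrite val_eqE.
rewrite !(orient_edge o) in nE.
case: (eqVneq (edge_tail o e) (edge_tail o f)) => [E1|_].
  rewrite E1 in nE *; case: eqP => [E2|_]; first by rewrite E2 eqxx in nE.
  case: (eqVneq (edge_head o e) (edge_tail o f)) => [E2|_]; last by rewrite !mulr0 subr0.
  by rewrite E1 E2 eqxx in ef.
case: (eqVneq (edge_tail o e) (edge_head o f)) => [E1|_]; last by rewrite !mul0r subr0.
case: (eqVneq (edge_head o e) (edge_tail o f)) => [E2|_]; last by rewrite mul0r mulr0 subr0.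
by rewrite E1 E2 setUC eqxx in nE.
Qed.

Lemma orient_edgeP (e : edge G) u v : adj u v -> val e = [set u; v] ->
  (edge_tail o e = u /\ edge_head o e = v) \/ (edge_tail o e = v /\ edge_head o e = u).
Proof.
move=> uv; rewrite (orient_edge o) => E.
have : edge_tail o e \in [set u; v] by rewrite -E set21.
have : edge_head o e \in [set u; v] by rewrite -E set22.
have := adj_neq (edge_adj e).
rewrite !inE => ne /orP[]/eqP h /orP[]/eqP t; rewrite h t ?eqxx in ne *; by [left|right|].
Qed.

(** Each endpoint equality from the incidence part meets the same equality times an adjacency, with
    opposite sign, from the triangle part; together they give [nonadj]. *)
Lemma helmholtzianE i j :
  let e := enum_val i in let f := enum_val j in
  helmholtzian R o i j = helmholtzian_entry (edge_tail o e) (edge_head o e)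
    (edge_tail o f) (edge_head o f).
Proof.
move=> e f; rewrite !mxE.
have -> : \sum_k incidence R o i k * (incidence R o)^T k j =
    \sum_v incidence_coef R o e v * incidence_coef R o f v.
  rewrite [RHS](reindex _ (onW_bij _ (@enum_val_bij G))) /=.
  by apply: eq_bigr => k _; rewrite !mxE.
have -> : \sum_k (triangle_edge R o)^T i k * triangle_edge R o k j =
    \sum_t triangle_coef R o t e * triangle_coef R o t f.
  rewrite [RHS](reindex _ (onW_bij _ (@enum_val_bij (triangle G)))) /=.
  by apply: eq_bigr => k _; rewrite !mxE.
rewrite incidence_gram triangle_gram /helmholtzian_entry /nonadj; ring.
Qed.

End Entries.

(** * The join *)

Section JoinHelmholtzian.
Variables (R : rcfType) (G1 G2 : sgraph).
Variables (o1 : orientation G1) (o2 : orientation G2).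
Variable o : orientation (graph_join G1 G2).
Local Notation J := (graph_join G1 G2).
Local Notation entry := (@helmholtzian_entry R J).

Local Notation index := 'I_(#|edge G1| + (#|edge G2| + #|G1| * #|G2|)).

(** With [join_head], a reference orientation of the join, independent of [o], in which the
    Helmholtzian is block diagonal. *)
Definition join_tail (i : index) : J :=
  match split i with
  | inl k => inl (edge_tail o1 (enum_val k))
  | inr k => match split k with
    | inl l => inr (edge_tail o2 (enum_val l))
    | inr p => inl (enum_val (mxtens_unindex p).1)
    end
  end.

Definition join_head (i : index) : J :=
  match split i with
  | inl k => inl (edge_head o1 (enum_val k))
  | inr k => match split k with
    | inl l => inr (edge_head o2 (enum_val l))
    | inr p => inr (enum_val (mxtens_unindex p).2)
    end
  end.

Lemma split_lshift m n (k : 'I_m) : split (lshift n k) = inl k.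
Proof. exact: (unsplitK (inl _)). Qed.

Lemma split_rshift m n (k : 'I_n) : split (rshift m k) = inr k.
Proof. exact: (unsplitK (inr _)). Qed.

Let splitE := (split_lshift, split_rshift, @mxtens_indexK).

Variant join_index_spec : index -> J -> J -> Type :=
  | Left_edge k : join_index_spec (lshift _ k)
      (inl (edge_tail o1 (enum_val k))) (inl (edge_head o1 (enum_val k)))
  | Right_edge k : join_index_spec (rshift _ (lshift _ k))
      (inr (edge_tail o2 (enum_val k))) (inr (edge_head o2 (enum_val k)))
  | Cross_edge k l : join_index_spec (rshift _ (rshift _ (mxtens_index (k, l))))
      (inl (enum_val k)) (inr (enum_val l)).

Lemma join_indexP i : join_index_spec i (join_tail i) (join_head i).
Proof.
rewrite /join_tail /join_head; case: (split_ordP i) => k ->; first by constructor.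
case: (split_ordP k) => l ->; first by constructor.
by case: (mxtens_indexP l) => x y; rewrite !mxtens_indexK /=; constructor.
Qed.

Lemma join_adjP i : adj (join_tail i) (join_head i).
Proof. by case: join_indexP => [k|k|k l] //=; apply: edge_adj. Qed.

Lemma join_edge_subproof i : [set join_tail i; join_head i] \in edges J.
Proof. by apply/imset2P; exists (join_tail i) (join_head i); rewrite ?inE ?join_adjP. Qed.

Definition join_edge i : edge J := exist (fun t => t \in edges J) _ (join_edge_subproof i).

Definition join_sign i : R := if edge_tail o (join_edge i) == join_tail i then 1 else -1.

Lemma join_entry i j :
  entry (edge_tail o (join_edge i)) (edge_head o (join_edge i))
    (edge_tail o (join_edge j)) (edge_head o (join_edge j)) =
  join_sign i * join_sign j *
    entry (join_tail i) (join_head i) (join_tail j) (join_head j).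
Proof.
have ne k : (join_head k == join_tail k) = false.
  by rewrite eq_sym (negPf (adj_neq (join_adjP k))).
rewrite /join_sign.
have := orient_edgeP o (join_adjP i) (erefl (val (join_edge i))).
have := orient_edgeP o (join_adjP j) (erefl (val (join_edge j))).
by case=> -[-> ->]; case=> -[-> ->]; rewrite ?eqxx ?ne
  ?(helmholtzian_entry_flipl _ (join_tail i))
  ?(helmholtzian_entry_flipr _ _ _ (join_tail j)); ring.
Qed.

(** Counterpart of [edge_deltaE] for the reference orientation; it serves for injectivity of
    [join_edge] and for the vanishing blocks. *)
Lemma join_delta i j :
  edge_delta R (join_tail i) (join_head i) (join_tail j) (join_head j) = (i == j)%:R.
Proof.
case: (join_indexP i) => [k|k|k l]; case: (join_indexP j) => [k'|k'|k' l'];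
  rewrite ?(eq_lshift, eq_rshift, eq_lrshift, eq_rlshift).
- by rewrite -(inj_eq enum_val_inj) -(edge_deltaE R o1).
- by rewrite /edge_delta /= !mul0r subr0.
- by rewrite /edge_delta /= mulr0 mul0r subr0.
- by rewrite /edge_delta /= !mul0r subr0.
- by rewrite -(inj_eq enum_val_inj) -(edge_deltaE R o2).
- by rewrite /edge_delta /= mul0r mulr0 subr0.
- by rewrite /edge_delta /= mulr0 mulr0 subr0.
- by rewrite /edge_delta /= mul0r mul0r subr0.
rewrite /edge_delta /= mul0r subr0 (can_eq (@mxtens_indexK _ _)) xpair_eqE.
by rewrite -!(inj_eq enum_val_inj) -mulnb natrM.
Qed.

(** Equal endpoint sets make [edge_delta] 1 or -1, whereas [join_delta] gives 0 for distinct
    indices. *)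
Lemma join_edge_inj : injective join_edge.
Proof.
move=> i j /(congr1 val) /= E; apply/eqP.
have := join_delta i j; rewrite /edge_delta.
have ne k := negPf (adj_neq (join_adjP k)).
have : join_tail i \in [set join_tail j; join_head j] by rewrite -E set21.
have : join_head i \in [set join_tail j; join_head j] by rewrite -E set22.
rewrite !inE; case: (i == j) => // /orP[]/eqP h /orP[]/eqP t; have := ne i; rewrite h t ?eqxx //.
- by rewrite eq_sym ne !mul0r sub0r mulr1 => _ /eqP; rewrite oppr_eq0 oner_eq0.
- by rewrite ne mul0r subr0 mulr1 => _ /eqP; rewrite oner_eq0.
Qed.

(** The boolean equality lets [xchoose] extract an inverse of [join_edge]. *)
Lemma join_edge_surj (e : edge J) : exists i, join_edge i == e.
Proof.
suff [i E] : exists i, val e = [set join_tail i; join_head i].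
  by exists i; rewrite -val_eqE /= -E.
have cross (x : G1) (y : G2) :
    exists i, [set (inl x : J); inr y] = [set join_tail i; join_head i].
  exists (rshift _ (rshift _ (mxtens_index (enum_rank x, enum_rank y)))).
  by rewrite /join_tail /join_head !splitE /= !enum_rankK.
have /imset2P[[x|x] [y|y] _] := valP e; rewrite inE /= => xy ->.
- have xyE : [set x; y] \in edges G1 by apply/imset2P; exists x y; rewrite ?inE.
  pose e1 : edge G1 := exist (fun t => t \in edges G1) _ xyE.
  exists (lshift _ (enum_rank e1)); rewrite /join_tail /join_head splitE enum_rankK.
  by case: (orient_edgeP o1 xy (erefl (val e1))) => -[-> ->] //; rewrite setUC.
- exact: cross.
- by rewrite setUC; apply: cross.
- have xyE : [set x; y] \in edges G2 by apply/imset2P; exists x y; rewrite ?inE.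
  pose e2 : edge G2 := exist (fun t => t \in edges G2) _ xyE.
  exists (rshift _ (lshift _ (enum_rank e2))); rewrite /join_tail /join_head !splitE enum_rankK.
  by case: (orient_edgeP o2 xy (erefl (val e2))) => -[-> ->] //; rewrite setUC.
Qed.

Lemma join_edge_bij : bijective (fun i => enum_rank (join_edge i)).
Proof.
pose g (j : 'I_#|edge J|) := xchoose (join_edge_surj (enum_val j)).
have gK : cancel g (fun i => enum_rank (join_edge i)).
  by move=> j; rewrite (eqP (xchooseP (join_edge_surj (enum_val j)))) enum_valK.
by exists g => // i; apply/join_edge_inj/enum_rank_inj; rewrite gK.
Qed.

Variables r1 r2 : nat.
Hypotheses (reg1 : regular G1 r1) (reg2 : regular G2 r2).

Definition join_helmholtzian : 'M[R]_(#|edge G1| + (#|edge G2| + #|G1| * #|G2|)) :=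
  block_mx (helmholtzian R o1 + #|G2|%:R%:M) 0 0
    (block_mx (helmholtzian R o2 + #|G1|%:R%:M) 0 0
       (shifted_laplacian R G1 r1 *t 1%:M + 1%:M *t shifted_laplacian R G2 r2)).

Lemma natr_card (T : finType) : #|T|%:R = \sum_(x : T) 1 :> R.
Proof. by rewrite sumr_const. Qed.

(** Every vertex of [G2] is adjacent to both [a] and [b]; this is the source of the spectral shift
    by [n2]. *)
Lemma common_nbrs_inl a b : common_nbrs R (inl a : J) (inl b) =
  common_nbrs R a b + #|G2|%:R.
Proof. by rewrite !common_nbrsE big_sumType natr_card. Qed.

Lemma common_nbrs_inr a b : common_nbrs R (inr a : J) (inr b) =
  common_nbrs R a b + #|G1|%:R.
Proof. by rewrite !common_nbrsE big_sumType addrC natr_card. Qed.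

(** The common neighbours are those of [x] in [G1] and those of [y] in [G2]; regularity makes their
    number constant. *)
Lemma common_nbrs_cross x y : common_nbrs R (inl x : J) (inr y) = r1%:R + r2%:R.
Proof.
rewrite common_nbrsE big_sumType /= -(regular_sum R reg1 x) -(regular_sum R reg2 y).
by congr (_ + _); apply: eq_bigr => z _; rewrite andbT.
Qed.

Lemma entry_inl a b c d : entry (inl a) (inl b) (inl c) (inl d) =
  helmholtzian_entry R a b c d + #|G2|%:R * edge_delta R a b c d.
Proof. by rewrite /helmholtzian_entry common_nbrs_inl mulrDl addrA. Qed.

Lemma entry_inr a b c d : entry (inr a) (inr b) (inr c) (inr d) =
  helmholtzian_entry R a b c d + #|G1|%:R * edge_delta R a b c d.
Proof. by rewrite /helmholtzian_entry common_nbrs_inr mulrDl addrA. Qed.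

(** Head-to-tail coincidences are impossible between cross edges. Giving [r1] to the [nonadj] term
    of [G1] and [r2] to that of [G2] exhibits the Kronecker sum of the shifted Laplacians. *)
Lemma entry_cross x y x' y' : entry (inl x) (inr y) (inl x') (inr y') =
  (x == x')%:R * nonadj R y y' + (y == y')%:R * nonadj R x x'
  + (r1%:R + r2%:R) * ((x == x')%:R * (y == y')%:R).
Proof.
rewrite /helmholtzian_entry common_nbrs_cross /edge_delta.
by rewrite /= !mul0r !subr0.
Qed.

Lemma join_helmholtzianE i j :
  join_helmholtzian i j =
  entry (join_tail i) (join_head i) (join_tail j) (join_head j).
Proof.
have zero a b c d : (a == c)%:R * nonadj R b d = 0 -> (b == d)%:R * nonadj R a c = 0 ->
    (a == d)%:R * nonadj R b c = 0 -> (b == c)%:R * nonadj R a d = 0 ->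
    edge_delta R a b c d = 0 -> entry a b c d = 0.
  by rewrite /helmholtzian_entry => -> -> -> -> ->; rewrite mulr0 !addr0 oppr0 !addr0.
have nonadj_cross x y : nonadj R (inl x : J) (inr y) = 0 by rewrite /nonadj subrr.
have nonadj_cross' x y : nonadj R (inr x : J) (inl y) = 0 by rewrite /nonadj subrr.
have zeros := (nonadj_cross, nonadj_cross', mulr0, mul0r).
case: (join_indexP i) (join_delta i) => [k|k|k l] dl;
  case: (join_indexP j) (dl j) => [k'|k'|k' l'] {dl};
  rewrite ?(eq_lshift, eq_rshift, eq_lrshift, eq_rlshift) => dl;
  rewrite /join_helmholtzian ?(block_mxEul, block_mxEur, block_mxEdl, block_mxEdr);
  (* This closes the six mixed blocks: a shared endpoint there leaves the other two on opposite
     sides, hence adjacent. The three diagonal blocks remain. *)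
  try by rewrite ?mxE zero ?zeros.
- rewrite mxE helmholtzianE mxE entry_inl edge_deltaE (inj_eq enum_val_inj).
  by rewrite mulr_natr.
- rewrite mxE helmholtzianE mxE entry_inr edge_deltaE (inj_eq enum_val_inj).
  by rewrite mulr_natr.
rewrite mxE !tensmxE !mxE entry_cross /nonadj !(inj_eq enum_val_inj).
rewrite -![_%:R *+ _]mulr_natr; ring.
Qed.

(** The bijection [join_edge] with the signs [join_sign], which compare [o] with the reference
    orientation, is a signed permutation conjugating one matrix to the other. *)
Lemma char_poly_join_helmholtzian :
  char_poly (helmholtzian R o) = char_poly join_helmholtzian.
Proof.
apply/esym/(char_poly_reindex (s := join_sign) join_edge_bij).
  by move=> i; rewrite /join_sign; case: ifP; rewrite ?oppr_eq0 oner_eq0.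
move=> i j; rewrite helmholtzianE !enum_rankK join_entry -join_helmholtzianE.
have ss : join_sign i * join_sign i = 1.
  by rewrite /join_sign; case: ifP; rewrite ?mulrNN mulr1.
by rewrite !mulrA ss mul1r mulrC.
Qed.

End JoinHelmholtzian.

Theorem theorem3p23 (R : rcfType) (G1 G2 : sgraph)
  (r1 r2 n1 n2 m1 m2 : nat)
  (o1 : orientation G1) (o2 : orientation G2) (o : orientation (graph_join G1 G2))
  (lam1 : m1.-tuple R) (lam2 : m2.-tuple R)
  (mu1 : n1.-tuple R) (mu2 : n2.-tuple R)
  (hn1 : #|G1| = n1) (hn2 : #|G2| = n2)
  (hm1 : #|edge G1| = m1) (hm2 : #|edge G2| = m2)
  (n1_gt0 : (0 < n1)%N) (n2_gt0 : (0 < n2)%N)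
  (reg1 : regular G1 r1) (reg2 : regular G2 r2)
  (lam1_sorted : sorted >=%R lam1) (lam2_sorted : sorted >=%R lam2)
  (mu1_sorted : sorted >=%R mu1) (mu2_sorted : sorted >=%R mu2)
  (lam1_spec : spectrum (helmholtzian R o1) lam1)
  (lam2_spec : spectrum (helmholtzian R o2) lam2)
  (mu1_spec : spectrum (adjacency R G1) mu1)
  (mu2_spec : spectrum (adjacency R G2) mu2) :
  spectrum (helmholtzian R o)
    ([seq l + n2%:R | l <- lam1] ++
     [seq l + n1%:R | l <- lam2] ++
     [:: n1%:R + n2%:R] ++
     [seq n1%:R + r2%:R - b | b <- behead mu2] ++
     [seq n2%:R + r1%:R - a | a <- behead mu1] ++
     [seq r1%:R + r2%:R - a - b | a <- behead mu1, b <- behead mu2]).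
Proof.
have laplacian_spec G r n (mu : n.-tuple R) : regular G r -> (0 < n)%N -> #|G| = n ->
    sorted >=%R mu -> spectrum (adjacency R G) mu ->
    spectrum (shifted_laplacian R G r) (n%:R :: [seq r%:R - b | b <- behead mu]).
  move=> reg n0 cG smu mu_spec; rewrite -[in n%:R]cG.
  apply: char_poly_shifted_laplacian => //.
  by rewrite -(regular_spectrum_head reg n0 cG smu mu_spec).
have K1 := laplacian_spec _ _ _ _ reg1 n1_gt0 hn1 mu1_sorted mu1_spec.
have K2 := laplacian_spec _ _ _ _ reg2 n2_gt0 hn2 mu2_sorted mu2_spec.
have shift (m n : nat) (M : 'M[R]_m) (s : seq R) : spectrum M s ->
    char_poly (M + n%:R%:M) = \prod_(x <- [seq l + n%:R | l <- s]) ('X - x%:P).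
  move=> /(char_poly_affine 1 n%:R); rewrite scale1r big_map => ->.
  by apply: eq_bigr => x _; rewrite mul1r.
rewrite /spectrum (char_poly_join_helmholtzian R o1 o2 o reg1 reg2) !char_poly_lblock.
rewrite (shift _ _ _ _ lam1_spec) (shift _ _ _ _ lam2_spec) (char_poly_kronecker_sum K1 K2).
rewrite hn1 hn2 [LHS]mulrA [LHS]mulrC big_allpairs_dep /=.
(* Separating the heads [n1] and [n2] of the two shifted Laplacian spectra splits their pairwise
   sums into the last four families of the statement. *)
under eq_bigr do rewrite big_cons big_map.
rewrite big_split /= !(big_cat, big_cons, big_map) /= big_allpairs_dep /=.
rewrite [RHS]mulrA [RHS]mulrC; congr (_ * _); rewrite -mulrA; congr (_ * _).
rewrite mulrCA; congr (_ * (_ * _)).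
- by apply: eq_bigr => b _; rewrite addrA.
- by apply: eq_bigr => a _; congr ('X - _%:P); ring.
apply: eq_bigr => a _; apply: eq_bigr => b _; congr ('X - _%:P); ring.
Qed.
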